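(* For every $h\in C_\mathbb{R}(\mathcal{X}^n)$ and every $\mu_1,\dots,\mu_n\in\mathrm{Prob}(\mathcal{X})$, $$P(h)\ge P_\mathrm{sym}(h:\mu_1,\dots,\mu_n)+\sum_{i=1}^nS(\mu_i),$$ and the following are equivalent: (i) $P(h)=P_\mathrm{sym}(h:\mu_1,\dots,\mu_n)+\sum_{i=1}^nS(\mu_i)$; (ii) $\mu_1,\dots,\mu_n$ are the marginals of the Gibbs measure $\mu_h(\mathbf{x})=Z_h^{-1}e^{h(\mathbf{x})}$, $\mathbf{x}\in\mathcal{X}^n$, $Z_h=\sum_{\mathbf{x}\in\mathcal{X}^n}e^{h(\mathbf{x})}$; (iii) for each $i$, $\mu_i$ is the Gibbs measure on $\mathcal{X}$ associated with $h_i(x)=\log\sum_{x_1,\dots,x_{i-1},x_{i+1},\dots,x_n\in\mathcal{X}}e^{h(x_1,\dots,x_{i-1},x,x_{i+1},\dots,x_n)}$.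
   Context: $\mathcal{X}=\{t_1,\dots,t_d\}$ is a finite set with a fixed order $t_1<\dots<t_d$; $n\in\mathbb{N}$. $\mathrm{Prob}(\mathcal{X}^k)$ is the set of probability measures on $\mathcal{X}^k$, $C_\mathbb{R}(\mathcal{X}^k)$ the real functions on $\mathcal{X}^k$ with max-norm. Shannon entropy: $S(\mu)=-\sum_t\mu(t)\log\mu(t)$. Pressure: $P(h)=\log\sum_{\mathbf{x}\in\mathcal{X}^k}e^{h(\mathbf{x})}$; the Gibbs measure associated with $h$ is $e^{h(\mathbf{x})-P(h)}$. For $\mathbf{x}=(x_1,\dots,x_N)\in\mathcal{X}^N$ its type is $\nu_\mathbf{x}(t)=\#\{j:x_j=t\}/N$. $\mathcal{X}_\le^N$ is the set of sequences in $\mathcal{X}^N$ of the form $(t_1,\dots,t_1,t_2,\dots,t_2,\dots,t_d,\dots,t_d)$ (nondecreasing). $S_N$ acts on $\mathcal{X}^N$ by $\sigma(\mathbf{x})=(x_{\sigma^{-1}(1)},\dots,x_{\sigma^{-1}(N)})$. An approximating sequence for $(\mu_1,\dots,\mu_n)$ is $\Xi(N)=(\xi_1(N),\dots,\xi_n(N))$ with $\xi_i(N)\in\mathcal{X}_\le^N$ and $\nu_{\xi_i(N)}(t)\to\mu_i(t)$ as $N\to\infty$ for all $t\in\mathcal{X}$, $1\le i\le n$. For $h\in C_\mathbb{R}(\mathcal{X}^n)$ and $\mathbf{x}_i=(x_{i1},\dots,x_{iN})\in\mathcal{X}^N$, $\kappa_N(h(\mathbf{x}_1,\dots,\mathbf{x}_n))=\frac1N\sum_{j=1}^Nh(x_{1j},\dots,x_{nj})$.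 The mutual pressure is $$P_\mathrm{sym}(h:\mu_1,\dots,\mu_n)=\limsup_{N\to\infty}\frac1N\log\Biggl[\frac1{(N!)^n}\sum_{\sigma_1,\dots,\sigma_n\in S_N}\exp\bigl(N\kappa_N(h(\sigma_1(\xi_1(N)),\dots,\sigma_n(\xi_n(N))))\bigr)\Biggr]$$ (independent of the approximating sequence). *)

(* Defs.v *)
From HB Require Import structures.
From Stdlib Require Import Reals.
From mathcomp Require Import all_boot all_order all_fingroup.
Set Implicit Arguments. Unset Strict Implicit. Unset Printing Implicit Defensive.
Open Scope R_scope.

HB.instance Definition _ := Monoid.isComLaw.Build R 0 Rplus (fun a b c => esym (Rplus_assoc a b c)) Rplus_comm Rplus_0_l.

Notation "\rsum_ ( i : T ) F" := (\big[Rplus/0]_(i : T) F) (at level 41, F at level 41, i, T at level 50).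
Notation "\rsum_ ( i | P ) F" := (\big[Rplus/0]_(i | P) F) (at level 41, F at level 41, i at level 50).

(* The alphabet X = {t_1 < ... < t_d} is modelled as 'I_d with its natural order.
   X^k is {ffun 'I_k -> 'I_d}. *)

Definition is_prob (d : nat) (mu : 'I_d -> R) : Prop :=
  (forall t, 0 <= mu t) /\ \rsum_(t : 'I_d) mu t = 1.

(* Shannon entropy (Stdlib's ln 0 = 0, so 0 log 0 = 0 as usual). *)
Definition entropy (d : nat) (mu : 'I_d -> R) : R :=
  - \rsum_(t : 'I_d) (mu t * ln (mu t)).

Definition pressure (T : finType) (g : T -> R) : R :=
  ln (\rsum_(x : T) exp (g x)).

Definition gibbs (T : finType) (g : T -> R) (x : T) : R :=
  exp (g x - pressure g).

Definition hmarg (d n : nat) (h : {ffun 'I_n -> 'I_d} -> R) (i : 'I_n) (t : 'I_d) : R :=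
  ln (\big[Rplus/0]_(x : {ffun 'I_n -> 'I_d} | x i == t) exp (h x)).

Definition type_of (d N : nat) (x : {ffun 'I_N -> 'I_d}) (t : 'I_d) : R :=
  INR #|[set j | x j == t]| / INR N.

Definition nondecr (d N : nat) (x : {ffun 'I_N -> 'I_d}) : Prop :=
  forall j k : 'I_N, (j <= k)%N -> (x j <= x k)%N.

Definition approx_seq (d n : nat) (mu : 'I_n -> 'I_d -> R)
    (Xi : forall N : nat, 'I_n -> {ffun 'I_N -> 'I_d}) : Prop :=
  (forall N i, nondecr (Xi N i)) /\
  (forall i t, Un_cv (fun N => type_of (Xi N i) t) (mu i t)).

Definition perm_act (d N : nat) (s : {perm 'I_N}) (x : {ffun 'I_N -> 'I_d})
  : {ffun 'I_N -> 'I_d} := [ffun j => x ((s^-1)%g j)].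

Definition Nkappa (d n N : nat) (h : {ffun 'I_n -> 'I_d} -> R)
    (xs : 'I_n -> {ffun 'I_N -> 'I_d}) : R :=
  \rsum_(j : 'I_N) h [ffun i => xs i j].

(* The N-th term of the sequence whose limsup is the mutual pressure:
   (1/N) log [ (N!)^{-n} sum_{sigma_1..sigma_n in S_N} exp(N kappa_N(...)) ]. *)
Definition Psym_term (d n : nat) (h : {ffun 'I_n -> 'I_d} -> R)
    (Xi : forall N : nat, 'I_n -> {ffun 'I_N -> 'I_d}) (N : nat) : R :=
  / INR N * ln (/ (INR (N`!) ^ n) *
     \rsum_(s : {ffun 'I_n -> {perm 'I_N}})
        exp (Nkappa h (fun i => perm_act (s i) (Xi N i)))).

Definition is_limsup (u : nat -> R) (l : R) : Prop :=
  forall eps : R, 0 < eps ->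
    (exists N0 : nat, forall N, (N0 <= N)%nat -> u N < l + eps) /\
    (forall N0 : nat, exists N, (N0 <= N)%nat /\ l - eps < u N).

(* Main.v *)
(** The expectation over independent permutations depends on the approximating sequence
    only through the letter counts, and it is Lipschitz in them: sequences with nearby counts
    can be aligned by a permutation so as to differ in few places.  Hence it is comparable,
    up to [exp (N * O(delta))], with its value at every family [w] whose counts are
    [delta]-close to [mu].  Summing over these typical families, permutations disappear and
    the sum is [exp (N * P(h))] times the probability that i.i.d. samples of the Gibbs
    measure are typical, while the number of typical families is about
    [exp (N * sum of the entropies)], by the law of large numbers under the product of the
    [mu i].  The probability is at most 1, which gives the inequality, and at least 1/2 when
    the [mu i] are the Gibbs marginals, which gives equality in that case.

    Conversely, adding [s * 1_{x_i = t}] to [h] changes the mutual pressure by exactly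
    [s * mu i t]; if equality holds at [h], the inequality for the tilted potentials makes
    [s |-> s * mu i t] a supporting line at 0 of the increment of the pressure, whose
    derivative there is the Gibbs marginal. *)

Require Import Defs.
From HB Require Import structures.
From Stdlib Require Import Reals Lra.
From mathcomp Require Import all_boot all_order all_fingroup.
Set Implicit Arguments. Unset Strict Implicit. Unset Printing Implicit Defensive.
Open Scope R_scope.

(** * Finite sums and products of reals *)

HB.instance Definition _ := Monoid.isComLaw.Build R 1 Rmult
  (fun a b c => esym (Rmult_assoc a b c)) Rmult_comm Rmult_1_l.
HB.instance Definition _ := Monoid.isMulLaw.Build R 0 Rmult Rmult_0_l Rmult_0_r.
HB.instance Definition _ := Monoid.isAddLaw.Build R Rmult Rplus
  Rmult_plus_distr_r Rmult_plus_distr_l.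

(** Boolean form of the order, so that typicality can serve as the predicate of a finite sum. *)
Definition rle (a b : R) : bool := if Rle_dec a b then true else false.

Lemma rleP (a b : R) : reflect (a <= b) (rle a b).
Proof. by rewrite /rle; case: Rle_dec => H; constructor. Qed.

Section Sums.
Variables (I : finType).
Implicit Types (P : pred I) (F G : I -> R).

Lemma rsum_le P F G : (forall i, P i -> F i <= G i) ->
  \big[Rplus/0]_(i | P i) F i <= \big[Rplus/0]_(i | P i) G i.
Proof. by move=> H; elim/big_ind2: _ => //; [lra|move=> *; lra]. Qed.

Lemma rsum_ge0 P F : (forall i, P i -> 0 <= F i) ->
  0 <= \big[Rplus/0]_(i | P i) F i.
Proof. by move=> H; elim/big_ind: _ => //; [lra|move=> *; lra]. Qed.

Lemma rprod_ge0 P F : (forall i, P i -> 0 <= F i) ->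
  0 <= \big[Rmult/1]_(i | P i) F i.
Proof. by move=> H; elim/big_ind: _ => //; [lra|exact: Rmult_le_pos]. Qed.

Lemma rprod_le P F G : (forall i, P i -> 0 <= F i <= G i) ->
  \big[Rmult/1]_(i | P i) F i <= \big[Rmult/1]_(i | P i) G i.
Proof.
move=> H; suff: 0 <= \big[Rmult/1]_(i | P i) F i <= \big[Rmult/1]_(i | P i) G i by lra.
elim/big_ind2: _ => //; first lra.
by move=> *; split; [apply: Rmult_le_pos; lra | apply: Rmult_le_compat; lra].
Qed.

Lemma rsum_gt0 P F i0 : P i0 -> (forall i, P i -> 0 < F i) ->
  0 < \big[Rplus/0]_(i | P i) F i.
Proof.
move=> Pi0 H; rewrite (bigD1 i0) //=.
have := H _ Pi0.
have: 0 <= \big[Rplus/0]_(i | P i && (i != i0)) F i.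
  by apply: rsum_ge0 => i /andP[/H]; lra.
lra.
Qed.

Lemma rsum_sub P (Q : pred I) F : (forall i, 0 <= F i) -> (forall i, P i -> Q i) ->
  \big[Rplus/0]_(i | P i) F i <= \big[Rplus/0]_(i | Q i) F i.
Proof.
move=> H PQ; rewrite big_mkcond [X in _ <= X]big_mkcond; apply: rsum_le => i _.
by case: ifP => [/PQ->|_]; [lra|case: ifP => _; [exact: H|lra]].
Qed.

Lemma le_rsum1 P F i0 : P i0 -> (forall i, 0 <= F i) ->
  F i0 <= \big[Rplus/0]_(i | P i) F i.
Proof.
move=> Pi0 H; rewrite (bigD1 i0) //=.
have: 0 <= \big[Rplus/0]_(i | P i && (i != i0)) F i by apply: rsum_ge0.
lra.
Qed.

Lemma rsum_const P c : \big[Rplus/0]_(i | P i) c = INR #|[set i | P i]| * c.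
Proof.
rewrite (eq_bigl (fun i => i \in [set i | P i])); last by move=> i; rewrite inE.
rewrite big_const; elim: #|_| => [|m IH] /=; first by rewrite Rmult_0_l.
by rewrite IH; case: m {IH} => [|m]; rewrite ?S_INR /=; lra.
Qed.

Lemma rsum_opp P F : \big[Rplus/0]_(i | P i) - F i = - \big[Rplus/0]_(i | P i) F i.
Proof. by rewrite (big_morph Ropp Ropp_plus_distr Ropp_0). Qed.

Lemma exp_rsum P F :
  exp (\big[Rplus/0]_(i | P i) F i) = \big[Rmult/1]_(i | P i) exp (F i).
Proof. by apply: (big_morph exp exp_plus exp_0). Qed.

Lemma Rabs_rsum P F :
  Rabs (\big[Rplus/0]_(i | P i) F i) <= \big[Rplus/0]_(i | P i) Rabs (F i).
Proof.
apply: (big_ind2 (fun x y => Rabs x <= y)) => [|x1 x2 y1 y2 H1 H2|i _].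
- by rewrite Rabs_R0; lra.
- by have := Rabs_triang x1 y1; lra.
- by lra.
Qed.

Lemma rsum_indic P (Q : pred I) F :
  \big[Rplus/0]_(i | P i) (F i * (if Q i then 1 else 0)) =
  \big[Rplus/0]_(i | P i && Q i) F i.
Proof.
rewrite big_mkcondr; apply: eq_bigr => i _.
by case: ifP; rewrite ?Rmult_1_r ?Rmult_0_r.
Qed.

Lemma card_rsum (Q : pred I) :
  INR #|[set i | Q i]| = \big[Rplus/0]_(i : I) (if Q i then 1 else 0).
Proof. by rewrite -big_mkcond rsum_const Rmult_1_r. Qed.

End Sums.

(** * Exponential moments and the law of large numbers *)

Lemma rprod_const_ord N c : \big[Rmult/1]_(j < N) c = c ^ N.
Proof. by rewrite big_const_ord; elim: N => //= N ->. Qed.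

Lemma iid_mgf (A : finType) (p g : A -> R) N :
  \big[Rplus/0]_(w : {ffun 'I_N -> A}) \big[Rmult/1]_(j < N) (p (w j) * g (w j)) =
  (\big[Rplus/0]_(a : A) (p a * g a)) ^ N.
Proof. by rewrite -(bigA_distr_bigA (fun _ a => p a * g a)) rprod_const_ord. Qed.

Lemma iid_total (A : finType) (p : A -> R) N :
  \big[Rplus/0]_(w : {ffun 'I_N -> A}) \big[Rmult/1]_(j < N) p (w j) =
  (\big[Rplus/0]_(a : A) p a) ^ N.
Proof. by rewrite -(bigA_distr_bigA (fun _ a => p a)) rprod_const_ord. Qed.

(** Since [exp (- y) >= 1 - y > 0], [exp y] is at most [1 / (1 - y)], and [(1 + y + 2 y^2) (1 - y) =
    1 + y^2 (1 - 2 y) >= 1]. *)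
Lemma exp_le_quadratic y : y <= 1/2 -> exp y <= 1 + y + 2 * y ^ 2.
Proof.
move=> H.
have H1 : 1 - y <= exp (- y) by have := exp_ineq1_le (- y); lra.
have H2 : exp y * exp (- y) = 1 by rewrite -exp_plus Rplus_opp_r exp_0.
have H3 := exp_pos y.
have H4 : exp y * (1 - y) <= 1 by rewrite -H2; apply: Rmult_le_compat_l; lra.
have H5 : 1 <= (1 + y + 2 * y ^ 2) * (1 - y).
  have: 0 <= y ^ 2 * (1 - 2 * y) by apply: Rmult_le_pos; [exact: pow2_ge_0 | lra].
  lra.
by apply: (Rmult_le_reg_r (1 - y)); lra.
Qed.

Section LLN.
Variables (A K : finType) (p : A -> R) (f : K -> A -> R).
Hypothesis (p_ge0 : forall a, 0 <= p a) (p_sum : \big[Rplus/0]_(a : A) p a = 1).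

(** Independence turns the left side into the [N]-th power of a one-letter exponential moment, which
    is at most [1 + 2 s^2 <= exp (2 s^2)] by the quadratic bound, as [g] has mean zero. *)
Lemma iid_chernoff (g : A -> R) (s : R) N :
  (forall a, Rabs (g a) <= 1) -> \big[Rplus/0]_(a : A) (p a * g a) = 0 ->
  0 <= s <= 1/2 ->
  \big[Rplus/0]_(w : {ffun 'I_N -> A})
    (\big[Rmult/1]_(j < N) p (w j) * exp (s * \big[Rplus/0]_(j < N) g (w j)))
  <= exp (2 * s ^ 2 * INR N).
Proof.
move=> g1 g0 s12.
under eq_bigr => w _.
  rewrite (big_endo (Rmult s)); [|exact: Rmult_plus_distr_l|exact: Rmult_0_r].
  rewrite exp_rsum -big_split /=.
  over.
rewrite (iid_mgf p (fun a => exp (s * g a))).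
have -> : exp (2 * s ^ 2 * INR N) = exp (2 * s ^ 2) ^ N.
  by rewrite -(Rpower_pow N _ (exp_pos _)) /Rpower ln_exp; congr exp; ring.
apply: pow_incr; split.
  by apply: rsum_ge0 => a _; apply: Rmult_le_pos => //; left; exact: exp_pos.
apply: Rle_trans (_ : 1 + 2 * s ^ 2 <= _); last exact: exp_ineq1_le.
apply: Rle_trans (_ : \big[Rplus/0]_(a : A) (p a * (1 + 2 * s ^ 2) + p a * g a * s) <= _).
  apply: rsum_le => a _.
  have [ga1 ga2] : -1 <= g a <= 1.
    by have := g1 a; have := Rle_abs (g a); have := Rle_abs (- g a); rewrite Rabs_Ropp; lra.
  have: exp (s * g a) <= 1 + 2 * s ^ 2 + g a * s.
    apply: Rle_trans (exp_le_quadratic _) _; first nra.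
    have: g a ^ 2 <= 1 by nra.
    by move=> ?; have := pow2_ge_0 s; nra.
  by have := p_ge0 a; nra.
by rewrite big_split /= -!big_distrl /= p_sum g0; lra.
Qed.

Lemma exp_small (c eps : R) : 0 < c -> 0 < eps ->
  exists N0 : nat, forall N, (N0 <= N)%N -> exp (- (c * INR N)) <= eps.
Proof.
move=> c0 e0; have [N0 HN0] := INR_unbounded (/ (eps * c)).
exists N0 => N /leP /le_INR HN.
have cN : / (eps * c) < INR N by lra.
have ec : 0 < eps * c by apply: Rmult_lt_0_compat.
have cN' : 1 < eps * (c * INR N).
  have := Rmult_lt_compat_l _ _ _ ec cN; rewrite Rinv_r; lra.
rewrite exp_Ropp; apply: (Rmult_le_reg_l (exp (c * INR N))); first exact: exp_pos.
rewrite Rinv_r; last by have := exp_pos (c * INR N); lra.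
have := exp_ineq1_le (c * INR N); nra.
Qed.

(** Markov's inequality for the exponential moments of each sum and of its negative, with a union
    bound over [K]. *)
Lemma iid_lln (delta : R) : 0 < delta <= 1 ->
  (forall k a, Rabs (f k a) <= 1) ->
  (forall k, \big[Rplus/0]_(a : A) (p a * f k a) = 0) ->
  exists N0 : nat, forall N, (N0 <= N)%N ->
  1/2 <= \big[Rplus/0]_(w : {ffun 'I_N -> A} |
     [forall k, rle (Rabs (\big[Rplus/0]_(j < N) f k (w j))) (INR N * delta)])
       \big[Rmult/1]_(j < N) p (w j).
Proof.
move=> d01 f1 f0.
(* This value minimises [2 s^2 - s delta]; the minimum [- delta^2 / 8] is the rate below. The two
   tails for each [k] must add up to at most 1/2 over [K]. *)
set s := delta / 4.
have [N0 HN0] : exists N0 : nat, forall N, (N0 <= N)%N ->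
    exp (- (delta ^ 2 / 8 * INR N)) <= / (4 * (INR #|K| + 1)).
  apply: exp_small; first by nra.
  by apply: Rinv_0_lt_compat; have := pos_INR #|K|; lra.
exists N0 => N /HN0 {}HN0.
pose F (w : {ffun 'I_N -> A}) := \big[Rmult/1]_(j < N) p (w j).
pose S k (w : {ffun 'I_N -> A}) := \big[Rplus/0]_(j < N) f k (w j).
pose near w := [forall k, rle (Rabs (S k w)) (INR N * delta)].
rewrite -/near.
have F0 w : 0 <= F w by apply: rprod_ge0 => j _; exact: p_ge0.
set E := exp (- (s * (INR N * delta))).
have E0 : 0 < E by exact: exp_pos.
(* Markov's inequality pointwise: if [w] is not typical, some [S k w] exceeds [INR N * delta] in
   absolute value, and one of its two exponentials times [E] is at least 1. *)
have markov w : F w <= (if near w then F w else 0) +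
    \big[Rplus/0]_(k : K) ((F w * exp (s * S k w) + F w * exp (s * - S k w)) * E).
  have pos k : 0 <= (F w * exp (s * S k w) + F w * exp (s * - S k w)) * E.
    apply: Rmult_le_pos; last lra.
    by apply: Rplus_le_le_0_compat; apply: Rmult_le_pos => //; left; exact: exp_pos.
  set B := \big[Rplus/0]_(k : K) _.
  case: ifPn => [_|].
    suff: 0 <= B by lra.
    by apply: rsum_ge0.
  rewrite negb_forall => /existsP[k /rleP /Rnot_le_lt Hk].
  apply: Rle_trans (_ : (F w * exp (s * S k w) + F w * exp (s * - S k w)) * E <= _);
    last by rewrite Rplus_0_l; apply: (@le_rsum1 _ _ _ k).
  suff: F w <= (F w * exp (s * S k w) + F w * exp (s * - S k w)) * E by lra.
  have big x : INR N * delta <= x -> 1 <= exp (s * x) * E.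
    move=> Hx; rewrite /E -exp_plus -exp_0.
    have : 0 <= s * (x - INR N * delta) by apply: Rmult_le_pos; rewrite /s; lra.
    by case=> [H|H]; [left; apply: exp_increasing|right; congr exp]; lra.
  have e1 := exp_pos (s * S k w); have e2 := exp_pos (s * - S k w).
  rewrite -Rmult_plus_distr_l Rmult_assoc -{1}[F w]Rmult_1_r.
  apply: Rmult_le_compat_l => //.
  move: Hk; rewrite -/(S k w) /Rabs; case: Rcase_abs => _ Hk.
    by have := big (- S k w) ltac:(lra); nra.
  by have := big (S k w) ltac:(lra); nra.
have tot : \big[Rplus/0]_(w : {ffun 'I_N -> A}) F w = 1 by rewrite iid_total p_sum pow1.
pose Y := \big[Rplus/0]_(w | near w) F w; rewrite -[X in _ <= X]/Y.
pose X := \big[Rplus/0]_(k : K) \big[Rplus/0]_(w : {ffun 'I_N -> A})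
   ((F w * exp (s * S k w) + F w * exp (s * - S k w)) * E).
have YX : 1 <= Y + X.
  apply: Rle_trans (Req_le _ _ (esym tot)) _.
  rewrite /Y /X exchange_big (big_mkcond near) -big_split /=.
  by apply: rsum_le => w _; exact: markov.
suff: X <= 1/2 by lra.
rewrite /X.
have sN : 0 <= s <= 1/2 by rewrite /s; lra.
apply: Rle_trans (_ : \big[Rplus/0]_(k : K) (2 * exp (2 * s ^ 2 * INR N) * E) <= _).
  apply: rsum_le => k _; rewrite -big_distrl /= big_split /=.
  apply: Rmult_le_compat_r; first lra.
  rewrite RIneq.double; apply: Rplus_le_compat; first exact: iid_chernoff.
  under eq_bigr do rewrite -rsum_opp.
  apply: (@iid_chernoff (fun a => - f k a)) => // [a|]; first by rewrite Rabs_Ropp.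
  by under eq_bigr do rewrite Ropp_mult_distr_r_reverse; rewrite rsum_opp f0 Ropp_0.
rewrite rsum_const Rmult_assoc /E -exp_plus.
have -> : 2 * s ^ 2 * INR N + - (s * (INR N * delta)) = - (delta ^ 2 / 8 * INR N).
  by rewrite /s; field.
have -> : #|[set i : K | true]| = #|K| by rewrite cardsE.
have K0 := pos_INR #|K|.
apply: Rle_trans (_ : INR #|K| * (2 * / (4 * (INR #|K| + 1))) <= _).
  by apply: Rmult_le_compat_l => //; lra.
apply: (Rmult_le_reg_r (4 * (INR #|K| + 1))); first lra.
by field_simplify; lra.
Qed.
End LLN.

(** * Letter counts and alignment by permutations *)

Definition occ (d N : nat) (x : {ffun 'I_N -> 'I_d}) (t : 'I_d) : nat :=
  #|[set j | x j == t]|.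

Lemma perm_act_mul d N (s t : {perm 'I_N}) (x : {ffun 'I_N -> 'I_d}) :
  perm_act s (perm_act t x) = perm_act (t * s)%g x.
Proof. by apply/ffunP => j; rewrite !ffunE invMg permM. Qed.

Lemma occ_perm_act d N (s : {perm 'I_N}) (x : {ffun 'I_N -> 'I_d}) t :
  occ (perm_act s x) t = occ x t.
Proof.
rewrite /occ -[RHS](card_imset _ (@perm_inj _ s)); congr #|pred_of_set _|.
apply/setP => j; rewrite inE ffunE; apply/idP/imsetP => [H|[k]].
  by exists ((s^-1)%g j); rewrite ?inE // permKV.
by rewrite inE => H ->; rewrite permK.
Qed.

(* A permutation minimising the number of mismatches leaves no letter that is both in
   excess at one place and missing at another: swapping the two places would gain one match. *)
Lemma exists_aligning_perm d N (x y : {ffun 'I_N -> 'I_d}) :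
  exists s : {perm 'I_N}, forall t : 'I_d,
    (#|[set j | (perm_act s x j == t) && (y j != t)]| <= occ x t - occ y t)%N.
Proof.
pose mis (s : {perm 'I_N}) := [set j | perm_act s x j != y j].
have [s _ smin] := @arg_minnP _ (1%g : {perm 'I_N}) xpredT (fun s => #|mis s|) isT.
exists s => t; rewrite -(occ_perm_act s x); set z := perm_act s x.
case: (set_0Vmem [set j | (z j == t) && (y j != t)]) => [->|[j]]; first by rewrite cards0.
rewrite inE => /andP[/eqP zj yj].
have sub : [set k | y k == t] \subset [set k | z k == t].
  apply/subsetP => k; rewrite !inE => /eqP yk; apply: contraT => zk.
  have := smin (s * tperm j k)%g isT; rewrite leqNgt => /negP[].
  apply/proper_card/properP; split; last first.
    exists k; rewrite !inE; first by rewrite -/z yk.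
    by rewrite -perm_act_mul ffunE tpermV tpermR -/z zj yk eqxx.
  apply/subsetP => l; rewrite !inE -perm_act_mul ffunE tpermV -/z.
  case: tpermP => [->|->|//]; last by rewrite zj yk eqxx.
  by rewrite zj => _; rewrite eq_sym.
rewrite /occ -[X in (X - _)%N](cardsID [set k | y k == t]) (setIidPr sub) addKn.
by apply: subset_leq_card; apply/subsetP => k; rewrite !inE andbC.
Qed.

(** Each mismatch is charged to the letter that the permuted word has there; the truncated
    difference of counts is then at most the absolute one. *)
Lemma hamming_aligned d N (x y : {ffun 'I_N -> 'I_d}) :
  exists s : {perm 'I_N},
    \big[Rplus/0]_(j < N) (if perm_act s x j != y j then 1 else 0) <=
    \big[Rplus/0]_(t < d) Rabs (INR (occ x t) - INR (occ y t)).
Proof.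
have [s Hs] := exists_aligning_perm x y; exists s.
set z := perm_act s x.
have -> : \big[Rplus/0]_(j < N) (if z j != y j then 1 else 0) =
    \big[Rplus/0]_(t < d) INR #|[set j | (z j == t) && (y j != t)]|.
  under [RHS]eq_bigr do rewrite card_rsum.
  rewrite exchange_big; apply: eq_bigr => j _ /=.
  rewrite (bigD1 (z j)) //= eqxx big1 => [|t /negbTE]; last by rewrite eq_sym => ->.
  by rewrite Rplus_0_r eq_sym.
apply: rsum_le => t _; apply: Rle_trans (le_INR _ _ (elimT leP (Hs t))) _.
case: (leqP (occ y t) (occ x t)) => [le|/ltnW].
  by rewrite minus_INR; [exact: Rle_abs|exact/leP].
by rewrite -subn_eq0 => /eqP->; exact: Rabs_pos.
Qed.

(** * Lipschitz bound for the permutation average *)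

Definition osc_bound (T : finType) (h : T -> R) : R := 2 * \big[Rplus/0]_(a : T) Rabs (h a).

Lemma osc_bound_ge0 (T : finType) (h : T -> R) : 0 <= osc_bound h.
Proof. by apply: Rmult_le_pos; [lra|apply: rsum_ge0 => a _; exact: Rabs_pos]. Qed.

Lemma osc_boundP (T : finType) (h : T -> R) a b : h a <= h b + osc_bound h.
Proof.
have H c : Rabs (h c) <= \big[Rplus/0]_(a : T) Rabs (h a).
  by apply: (@le_rsum1 _ _ (fun a => Rabs (h a))) => // i; exact: Rabs_pos.
rewrite /osc_bound; have := H a; have := H b.
have := Rle_abs (h a); have := Rle_abs (- h b); rewrite Rabs_Ropp; lra.
Qed.

(** Only positions where some component differs contribute; there [m >= 1], and [h] changes by at
    most [osc_bound h], a crude bound on its maximum minus its minimum. *)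
Lemma Nkappa_hamming d n N (h : {ffun 'I_n -> 'I_d} -> R)
    (xs ys : 'I_n -> {ffun 'I_N -> 'I_d}) :
  Nkappa h xs <= Nkappa h ys + osc_bound h *
    \big[Rplus/0]_(i < n) \big[Rplus/0]_(j < N) (if xs i j != ys i j then 1 else 0).
Proof.
rewrite exchange_big big_distrr /= -big_split; apply: rsum_le => j _ /=.
set m := \big[Rplus/0]_(i < n) _.
have b01 (i : 'I_n) : 0 <= (if xs i j != ys i j then 1 else 0) by case: ifP => _; lra.
have m0 : 0 <= m by apply: rsum_ge0.
have [/forallP E|] := boolP [forall i, xs i j == ys i j].
  have -> : [ffun i => xs i j] = [ffun i => ys i j].
    by apply/ffunP => i; rewrite !ffunE; apply/eqP.
  rewrite -[X in X <= _]Rplus_0_r; apply: Rplus_le_compat_l.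
  exact: Rmult_le_pos (osc_bound_ge0 h) m0.
rewrite negb_forall => /existsP[i Hi].
have m1 : 1 <= m.
  by apply: Rle_trans (@le_rsum1 _ xpredT _ i isT b01); rewrite Hi; lra.
apply: Rle_trans (osc_boundP h _ [ffun i => ys i j]) _; apply: Rplus_le_compat_l.
by have := Rmult_le_compat_l _ _ _ (osc_bound_ge0 h) m1; lra.
Qed.

(** The expectation under the logarithm in [Psym_term], at an arbitrary family instead of [Xi N], so
    that families can be compared. *)
Definition perm_avg (d n N : nat) (h : {ffun 'I_n -> 'I_d} -> R)
    (xs : 'I_n -> {ffun 'I_N -> 'I_d}) : R :=
  / (INR (N`!) ^ n) * \rsum_(s : {ffun 'I_n -> {perm 'I_N}})
    exp (Nkappa h (fun i => perm_act (s i) (xs i))).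

Lemma fact_pow_gt0 N n : 0 < INR (N`!) ^ n.
Proof. by apply: pow_lt; apply: lt_0_INR; apply/ltP; exact: fact_gt0. Qed.

Lemma perm_avg_gt0 d n N (h : {ffun 'I_n -> 'I_d} -> R) (xs : 'I_n -> {ffun 'I_N -> 'I_d}) :
  0 < perm_avg h xs.
Proof.
apply: Rmult_lt_0_compat; first exact: Rinv_0_lt_compat (fact_pow_gt0 _ _).
by apply: (@rsum_gt0 _ _ _ [ffun _ => 1%g]) => // s _; exact: exp_pos.
Qed.

Lemma eq_Nkappa d n N (h : {ffun 'I_n -> 'I_d} -> R) (xs ys : 'I_n -> {ffun 'I_N -> 'I_d}) :
  xs =1 ys -> Nkappa h xs = Nkappa h ys.
Proof. by move=> E; apply: eq_bigr => j _; congr h; apply/ffunP => i; rewrite !ffunE E. Qed.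

Lemma perm_avg_act d n N (h : {ffun 'I_n -> 'I_d} -> R) (xs : 'I_n -> {ffun 'I_N -> 'I_d})
    (t : 'I_n -> {perm 'I_N}) :
  perm_avg h (fun i => perm_act (t i) (xs i)) = perm_avg h xs.
Proof.
congr Rmult.
rewrite [RHS](reindex_inj (h := fun s : {ffun 'I_n -> {perm 'I_N}} => [ffun i => (t i * s i)%g])).
  apply: eq_bigr => s _; congr exp; apply: eq_Nkappa => i.
  by rewrite perm_act_mul ffunE.
move=> s1 s2 /ffunP E; apply/ffunP => i; have := E i.
by rewrite !ffunE => /mulgI.
Qed.

(** By invariance each [xs i] may first be aligned with [ys i]; the exponents are then compared for
    the same tuple [s]. *)
Lemma perm_avg_occ d n N (h : {ffun 'I_n -> 'I_d} -> R) (xs ys : 'I_n -> {ffun 'I_N -> 'I_d}) :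
  perm_avg h xs <= perm_avg h ys * exp (osc_bound h *
    \big[Rplus/0]_(i < n) \big[Rplus/0]_(t < d) Rabs (INR (occ (xs i) t) - INR (occ (ys i) t))).
Proof.
have [t Ht] := fin_all_exists (fun i => hamming_aligned (xs i) (ys i)).
rewrite -(perm_avg_act h xs t) /perm_avg Rmult_assoc; apply: Rmult_le_compat_l.
  by left; exact: Rinv_0_lt_compat (fact_pow_gt0 _ _).
rewrite big_distrl /=; apply: rsum_le => s _; rewrite -exp_plus.
set u := Nkappa _ _; set v := Nkappa _ _ + _.
suff: u <= v by case=> [?|->]; [left; exact: exp_increasing|lra].
apply: Rle_trans (Nkappa_hamming _ _ _) _; apply: Rplus_le_compat_l.
apply: Rmult_le_compat_l (osc_bound_ge0 h) _; apply: rsum_le => i _.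
apply: Rle_trans (Ht i).
(* One permutation acting on both words leaves their Hamming distance unchanged. *)
rewrite [X in _ <= X](reindex_inj (@perm_inj _ (s i)^-1%g)) /=.
by right; apply: eq_bigr => j _; rewrite [perm_act (s i) _ _]ffunE [perm_act (s i) (ys i) _]ffunE.
Qed.

(** * Shuffles of words over the product alphabet *)

Definition col (d n N : nat) (w : {ffun 'I_N -> {ffun 'I_n -> 'I_d}}) (i : 'I_n)
  : {ffun 'I_N -> 'I_d} := [ffun j => w j i].

(** The action of [S_N^n] on [n] columns, carried over to words over [X^n], the form in which
    positions are independent. *)
Definition shuffle (d n N : nat) (s : {ffun 'I_n -> {perm 'I_N}})
    (w : {ffun 'I_N -> {ffun 'I_n -> 'I_d}}) : {ffun 'I_N -> {ffun 'I_n -> 'I_d}} :=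
  [ffun j => [ffun i => w ((s i)^-1%g j) i]].

Lemma col_shuffle d n N s (w : {ffun 'I_N -> {ffun 'I_n -> 'I_d}}) i :
  col (shuffle s w) i = perm_act (s i) (col w i).
Proof. by apply/ffunP => j; rewrite !ffunE. Qed.

Lemma shuffle_inj d n N s : injective (@shuffle d n N s).
Proof.
move=> w1 w2 E; apply/ffunP => j; apply/ffunP => i.
by move/ffunP: E => /(_ (s i j)) /ffunP /(_ i); rewrite !ffunE permK.
Qed.

Lemma expn_INR m k : INR (m ^ k)%N = INR m ^ k.
Proof. by elim: k => // k IH; rewrite expnS mult_INR IH. Qed.

(** After exchanging the sums, each shuffle is a bijection preserving [Q], so all [(N!)^n] tuples
    give the same sum and the average disappears. *)
Lemma sum_perm_avg d n N (h : {ffun 'I_n -> 'I_d} -> R)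
    (Q : pred {ffun 'I_N -> {ffun 'I_n -> 'I_d}}) :
  (forall s w, Q (shuffle s w) = Q w) ->
  \big[Rplus/0]_(w | Q w) perm_avg h (col w) =
  \big[Rplus/0]_(w | Q w) exp (\big[Rplus/0]_(j < N) h (w j)).
Proof.
move=> HQ; rewrite -big_distrr /= exchange_big /=.
rewrite (eq_bigr (fun=> \big[Rplus/0]_(w | Q w) exp (\big[Rplus/0]_(j < N) h (w j)))).
  rewrite rsum_const cardsT card_ffun card_ord -/('S_N) card_Sn expn_INR -Rmult_assoc Rinv_l.
    by rewrite Rmult_1_l.
  by have := fact_pow_gt0 N n; lra.
move=> s _; rewrite [RHS](reindex_inj (@shuffle_inj _ _ _ s)) /=.
apply: eq_big => [w|w _]; first by rewrite HQ.
congr exp; apply: eq_bigr => j _; congr h.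
by apply/ffunP => i; rewrite !ffunE.
Qed.

(** * Properties that hold for all large lengths *)

Definition eventually (P : nat -> Prop) : Prop :=
  exists N0 : nat, forall N, (N0 <= N)%N -> P N.

Lemma eventually_and (P Q : nat -> Prop) :
  eventually P -> eventually Q -> eventually (fun N => P N /\ Q N).
Proof.
move=> [N1 H1] [N2 H2]; exists (maxn N1 N2) => N; rewrite geq_max => /andP[L1 L2].
by split; [exact: H1|exact: H2].
Qed.

Lemma eventually_forall (K : finType) (P : K -> nat -> Prop) :
  (forall k, eventually (P k)) -> eventually (fun N => forall k, P k N).
Proof.
move=> /fin_all_exists[N0 H]; exists (\max_k N0 k) => N L k; apply: H.
exact: leq_trans (leq_bigmax k) L.
Qed.

Lemma eventually_large (a : R) : eventually (fun N => a <= INR N).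
Proof.
have [N0 HN0] := INR_unbounded a; exists N0 => N /leP /le_INR; lra.
Qed.

Lemma eventually_mul_large (a eps : R) : 0 < eps -> eventually (fun N => a <= INR N * eps).
Proof.
move=> e0; have [N0 H] := eventually_large (a / eps); exists N0 => N /H {}H.
have -> : a = a / eps * eps by field; lra.
by apply: Rmult_le_compat_r; lra.
Qed.

Lemma eventually_Un_cv (u : nat -> R) l eps :
  Un_cv u l -> 0 < eps -> eventually (fun N => Rabs (u N - l) < eps).
Proof. by move=> H /H[N0 HN0]; exists N0 => N /leP; exact: HN0. Qed.

Lemma Rle_eps a b : (forall eps, 0 < eps -> a <= b + eps) -> a <= b.
Proof.
move=> H; apply: Rnot_lt_le => L.
by have := H ((a - b) / 2) ltac:(lra); lra.
Qed.

(** * Gibbs measures on a finite set *)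

Section Gibbs.
Variables (T : finType) (a0 : T) (h : T -> R).

Lemma partition_gt0 : 0 < \big[Rplus/0]_(a : T) exp (h a).
Proof. by apply: (@rsum_gt0 _ _ _ a0) => // a _; exact: exp_pos. Qed.

Lemma exp_pressure : exp (pressure h) = \big[Rplus/0]_(a : T) exp (h a).
Proof. exact: exp_ln partition_gt0. Qed.

Lemma gibbs_gt0 a : 0 < gibbs h a.
Proof. exact: exp_pos. Qed.

Lemma gibbsK a : exp (pressure h) * gibbs h a = exp (h a).
Proof. by rewrite /gibbs -exp_plus; congr exp; ring. Qed.

Lemma gibbs_sum : \big[Rplus/0]_(a : T) gibbs h a = 1.
Proof.
apply: (Rmult_eq_reg_l (exp (pressure h))); last by have := exp_pos (pressure h); lra.
by rewrite Rmult_1_r {2}exp_pressure big_distrr; apply: eq_bigr => a _; exact: gibbsK.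
Qed.

End Gibbs.

(** * Counting typical families *)

Section Sandwich.
Variables (d n : nat) (mu : 'I_n -> 'I_d -> R).
Hypothesis mu_prob : forall i, is_prob (mu i).
Local Notation A := {ffun 'I_n -> 'I_d}.

(** Typicality, stated on unnormalised counts to match the sums in the law of large numbers without
    dividing by [N]. *)
Definition near (delta : R) N (w : {ffun 'I_N -> A}) : bool :=
  [forall k : 'I_n * 'I_d,
    rle (Rabs (INR (occ (col w k.1) k.2) - INR N * mu k.1 k.2)) (INR N * delta)].

Lemma nearP delta N (w : {ffun 'I_N -> A}) i t : near delta w ->
  Rabs (INR (occ (col w i) t) - INR N * mu i t) <= INR N * delta.
Proof. by move/forallP/(_ (i, t))/rleP. Qed.

Lemma near_shuffle delta N s (w : {ffun 'I_N -> A}) :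
  near delta (shuffle s w) = near delta w.
Proof. by apply: eq_forallb => k; rewrite col_shuffle occ_perm_act. Qed.

(** The law of large numbers for the centred indicators of [a i = t]. Any law with marginals [mu] is
    allowed, to serve both the product measure and the Gibbs measure. *)
Lemma near_lln (p : A -> R) delta : 0 < delta <= 1 ->
  (forall a, 0 <= p a) -> \big[Rplus/0]_(a : A) p a = 1 ->
  (forall i t, \big[Rplus/0]_(a : A | a i == t) p a = mu i t) ->
  eventually (fun N => 1/2 <= \big[Rplus/0]_(w : {ffun 'I_N -> A} | near delta w)
    \big[Rmult/1]_(j < N) p (w j)).
Proof.
move=> d01 p0 p1 pm.
pose f (k : 'I_n * 'I_d) (a : A) := (if a k.1 == k.2 then 1 else 0) - mu k.1 k.2.
have mu01 i t : 0 <= mu i t <= 1.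
  rewrite -pm; split; first by apply: rsum_ge0.
  by apply: Rle_trans (Req_le _ _ p1); exact: rsum_sub.
have [k a|k|N0 HN0] := @iid_lln A _ p f p0 p1 delta d01.
- by rewrite /f; move: (mu k.1 k.2) (mu01 k.1 k.2) => x ?; apply: Rabs_le; case: ifP => _; lra.
- rewrite /f; under eq_bigr do rewrite /Rminus Rmult_plus_distr_l.
  rewrite big_split /= rsum_indic -big_distrl /= p1 pm; lra.
exists N0 => N /HN0; congr (_ <= _); apply: eq_bigl => w.
apply: eq_forallb => k; congr (rle (Rabs _) _).
rewrite big_split /= rsum_const cardsT card_ord /occ card_rsum.
congr Rplus; last by lra.
by apply: eq_bigr => j _; rewrite ffunE.
Qed.

Definition prod_prob (a : A) : R := \big[Rmult/1]_(i < n) mu i (a i).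

Lemma prod_prob_ge0 a : 0 <= prod_prob a.
Proof. by apply: rprod_ge0 => i _; case: (mu_prob i). Qed.

Lemma prod_prob_sum : \big[Rplus/0]_(a : A) prod_prob a = 1.
Proof. by rewrite -bigA_distr_bigA big1 // => i _; case: (mu_prob i). Qed.

Lemma prod_prob_marginal i t : \big[Rplus/0]_(a : A | a i == t) prod_prob a = mu i t.
Proof.
(* Putting the constraint [a i = t] into the [i]-th factor keeps the summand a product, so the sum
   over [a] factorises. *)
pose F i' t' := mu i' t' * (if (i' == i) && (t' != t) then 0 else 1).
have -> : \big[Rplus/0]_(a : A | a i == t) prod_prob a =
    \big[Rplus/0]_(a : A) \big[Rmult/1]_(i' < n) F i' (a i').
  rewrite big_mkcond; apply: eq_bigr => a _; rewrite big_split /=.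
  rewrite -/(prod_prob a) [X in _ * X](bigD1 i) //= eqxx /=.
  rewrite [X in _ * (_ * X)]big1 => [|i' /negbTE->//].
  by case: ifP => _ /=; ring.
rewrite -bigA_distr_bigA (bigD1 i) //= [X in _ * X]big1 => [|i' /negbTE ii'].
  rewrite Rmult_1_r (bigD1 t) //= big1 => [|t' /negbTE tt'].
    by rewrite /F !eqxx /=; ring.
  by rewrite /F eqxx tt' /=; ring.
rewrite /F ii' /=; under eq_bigr do rewrite Rmult_1_r.
by case: (mu_prob i').
Qed.

Lemma sum_occ N (x : {ffun 'I_N -> 'I_d}) (g : 'I_d -> R) :
  \big[Rplus/0]_(j < N) g (x j) = \big[Rplus/0]_(t < d) (INR (occ x t) * g t).
Proof.
rewrite (partition_big x xpredT) //=; apply: eq_bigr => t _.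
rewrite -rsum_const; apply: eq_bigr => j /eqP->//.
Qed.

(** Log-likelihood under the product measure, except that letters of probability zero contribute 0
    because [ln 0 = 0]. Its exponential bounds the likelihood from above, with equality if all
    [mu i t] are positive. *)
Definition log_lik N (w : {ffun 'I_N -> A}) : R :=
  \big[Rplus/0]_(j < N) \big[Rplus/0]_(i < n) ln (mu i (w j i)).

Definition log_bound : R := \big[Rplus/0]_(i < n) \big[Rplus/0]_(t < d) Rabs (ln (mu i t)).

Definition total_entropy : R := \big[Rplus/0]_(i < n) entropy (mu i).

Lemma log_bound_ge0 : 0 <= log_bound.
Proof. by apply: rsum_ge0 => i _; apply: rsum_ge0 => t _; exact: Rabs_pos. Qed.

(** The quantity is linear in the deviations of the counts from [N * mu i t], with coefficients
    [ln (mu i t)]. *)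
Lemma log_lik_near delta N (w : {ffun 'I_N -> A}) : near delta w ->
  Rabs (log_lik w + INR N * total_entropy) <= INR N * delta * log_bound.
Proof.
move=> nw.
have -> : log_lik w + INR N * total_entropy = \big[Rplus/0]_(i < n) \big[Rplus/0]_(t < d)
    ((INR (occ (col w i) t) - INR N * mu i t) * ln (mu i t)).
  rewrite /log_lik exchange_big /total_entropy big_distrr /= -big_split /=.
  apply: eq_bigr => i _.
  have -> : \big[Rplus/0]_(j < N) ln (mu i (w j i)) =
      \big[Rplus/0]_(j < N) ln (mu i (col w i j)) by apply: eq_bigr => j _; rewrite ffunE.
  rewrite (sum_occ (col w i) (fun t => ln (mu i t))) /entropy -rsum_opp big_distrr /=.
  by rewrite -big_split /=; apply: eq_bigr => t _; ring.
rewrite /log_bound big_distrr /=; apply: Rle_trans (Rabs_rsum _ _) _; apply: rsum_le => i _.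
rewrite big_distrr /=; apply: Rle_trans (Rabs_rsum _ _) _; apply: rsum_le => t _.
by rewrite Rabs_mult; apply: Rmult_le_compat_r; [exact: Rabs_pos|exact: nearP].
Qed.

Lemma iid_le_exp_log_lik N (w : {ffun 'I_N -> A}) :
  \big[Rmult/1]_(j < N) prod_prob (w j) <= exp (log_lik w).
Proof.
rewrite exp_rsum; apply: rprod_le => j _; split; first exact: prod_prob_ge0.
rewrite exp_rsum; apply: rprod_le => i _; have [+ _] := mu_prob i => /(_ (w j i)) [H|<-].
  by rewrite exp_ln //; lra.
by split; [lra|left; exact: exp_pos].
Qed.

Lemma iid_eq_exp_log_lik N (w : {ffun 'I_N -> A}) : (forall i t, 0 < mu i t) ->
  \big[Rmult/1]_(j < N) prod_prob (w j) = exp (log_lik w).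
Proof.
move=> mu0; rewrite exp_rsum; apply: eq_bigr => j _.
by rewrite exp_rsum; apply: eq_bigr => i _; rewrite exp_ln.
Qed.

Lemma Rexp_le x y : x <= y -> exp x <= exp y.
Proof. by case=> [H|->]; [left; exact: exp_increasing|lra]. Qed.

(** Typical words have total mass at least 1/2, and each has mass at most [exp (N * (delta *
    log_bound - total_entropy))]. *)
Lemma card_near_lower delta : 0 < delta <= 1 ->
  eventually (fun N => 1/2 <= INR #|[set w : {ffun 'I_N -> A} | near delta w]| *
    exp (INR N * (delta * log_bound - total_entropy))).
Proof.
move=> d01.
have [N0 H] := near_lln d01 prod_prob_ge0 prod_prob_sum prod_prob_marginal.
exists N0 => N /H {}H; apply: Rle_trans H _; rewrite -rsum_const; apply: rsum_le => w nw.
apply: Rle_trans (iid_le_exp_log_lik w) _; apply: Rexp_le.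
by have := log_lik_near nw; have := Rle_abs (log_lik w + INR N * total_entropy); lra.
Qed.

(** Typical words have total mass at most 1. Positivity makes the exponential of [log_lik] their
    exact mass, which gives a lower bound for each. *)
Lemma card_near_upper delta N : (forall i t, 0 < mu i t) ->
  INR #|[set w : {ffun 'I_N -> A} | near delta w]| *
    exp (- (INR N * (delta * log_bound + total_entropy))) <= 1.
Proof.
move=> mu0; rewrite -rsum_const.
apply: Rle_trans (_ : \big[Rplus/0]_(w : {ffun 'I_N -> A})
    \big[Rmult/1]_(j < N) prod_prob (w j) <= _); last first.
  by rewrite iid_total prod_prob_sum pow1; lra.
apply: Rle_trans (_ : \big[Rplus/0]_(w : {ffun 'I_N -> A} | near delta w)
    \big[Rmult/1]_(j < N) prod_prob (w j) <= _); last first.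
  by apply: rsum_sub => // w; apply: rprod_ge0 => j _; exact: prod_prob_ge0.
apply: rsum_le => w nw; rewrite iid_eq_exp_log_lik //; apply: Rexp_le.
have := log_lik_near nw; have := Rle_abs (- (log_lik w + INR N * total_entropy)).
by rewrite Rabs_Ropp; lra.
Qed.

(** * Bounds on the terms of the mutual pressure *)

Variable (Xi : forall N : nat, 'I_n -> {ffun 'I_N -> 'I_d}).
Hypothesis HXi : approx_seq mu Xi.

Lemma approx_occ delta : 0 < delta ->
  eventually (fun N => forall k : 'I_n * 'I_d,
    Rabs (INR (occ (Xi N k.1) k.2) - INR N * mu k.1 k.2) <= INR N * delta).
Proof.
move=> d0; apply: eventually_forall => -[i t] /=.
have [N0 H] := eventually_and (eventually_large 1) (eventually_Un_cv (HXi.2 i t) d0).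
exists N0 => N /H [N1 {}H].
have -> : INR (occ (Xi N i) t) - INR N * mu i t = INR N * (type_of (Xi N i) t - mu i t).
  by rewrite /type_of -/(occ _ _); field; lra.
rewrite Rabs_mult (Rabs_pos_eq (INR N)); last lra.
by apply: Rmult_le_compat_l; lra.
Qed.

Variable h : A -> R.

(** There are [n * d] counts; two within [N * delta] of the same [N * mu i t] differ by at most
    [2 * N * delta]. *)
Definition lip_const : R := osc_bound h * (2 * INR n * INR d).

Lemma perm_avg_near delta : 0 < delta ->
  eventually (fun N => forall w : {ffun 'I_N -> A}, near delta w ->
    perm_avg h (Xi N) <= perm_avg h (col w) * exp (INR N * (delta * lip_const)) /\
    perm_avg h (col w) <= perm_avg h (Xi N) * exp (INR N * (delta * lip_const))).
Proof.
move=> d0; have [N0 H] := approx_occ d0; exists N0 => N /H {}H w nw.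
have bnd (g : 'I_n -> 'I_d -> R) : (forall i t, g i t <= 2 * (INR N * delta)) ->
    osc_bound h * \big[Rplus/0]_(i < n) \big[Rplus/0]_(t < d) g i t <=
    INR N * (delta * lip_const).
  move=> Hg; rewrite /lip_const.
  have -> : INR N * (delta * (osc_bound h * (2 * INR n * INR d))) =
    osc_bound h * \big[Rplus/0]_(i < n) \big[Rplus/0]_(t < d) (2 * (INR N * delta)).
    by rewrite !rsum_const !cardsT !card_ord; ring.
  apply: Rmult_le_compat_l (osc_bound_ge0 h) _.
  by apply: rsum_le => i _; apply: rsum_le => t _.
have tri i t : Rabs (INR (occ (Xi N i) t) - INR (occ (col w i) t)) <= 2 * (INR N * delta).
  have -> : INR (occ (Xi N i) t) - INR (occ (col w i) t) =
    (INR (occ (Xi N i) t) - INR N * mu i t) + - (INR (occ (col w i) t) - INR N * mu i t) by ring.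
  apply: Rle_trans (Rabs_triang _ _) _; rewrite Rabs_Ropp.
  by have := H (i, t); have := nearP i t nw; rewrite /=; lra.
split; apply: Rle_trans (perm_avg_occ _ _ _) _; apply: Rmult_le_compat_l;
  try (by left; exact: perm_avg_gt0); apply: Rexp_le; apply: bnd => i t //.
by rewrite Rabs_minus_sym.
Qed.

Lemma exp_sum_gibbs N (w : {ffun 'I_N -> A}) :
  exp (\big[Rplus/0]_(j < N) h (w j)) =
  exp (INR N * pressure h) * \big[Rmult/1]_(j < N) gibbs h (w j).
Proof.
rewrite -exp_rsum -exp_plus big_split /= rsum_const cardsT card_ord.
by congr exp; ring.
Qed.

(** A point of [X^n], which makes the partition function positive; its letters come from words of
    length 1. *)
Let a0 : A := [ffun i => Xi 1 i ord0].

Lemma Psym_termE N : Psym_term h Xi N = / INR N * ln (perm_avg h (Xi N)).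
Proof. by []. Qed.

Lemma choose_delta (C eps : R) : 0 <= C -> 0 < eps ->
  exists delta, 0 < delta <= 1 /\ delta * C <= eps.
Proof.
move=> C0 e0; exists (Rmin 1 (eps / (C + 1))); have C1 : 0 < C + 1 by lra.
have e1 : 0 < eps / (C + 1) by apply: Rdiv_lt_0_compat.
split; first by split; [apply: Rmin_glb_lt; lra|exact: Rmin_l].
apply: Rle_trans (_ : eps / (C + 1) * (C + 1) <= _); last by right; field; lra.
have m0 : 0 < Rmin 1 (eps / (C + 1)) by apply: Rmin_glb_lt; lra.
by have := Rmin_r 1 (eps / (C + 1)); nra.
Qed.

Lemma slack_ge0 : 0 <= log_bound + lip_const.
Proof.
apply: Rplus_le_le_0_compat; first exact: log_bound_ge0.
apply: Rmult_le_pos (osc_bound_ge0 h) _.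
by apply: Rmult_le_pos; [apply: Rmult_le_pos; [lra|]|]; exact: pos_INR.
Qed.

Lemma Psym_term_upper eps : 0 < eps ->
  eventually (fun N => Psym_term h Xi N <= pressure h - total_entropy + eps).
Proof.
move=> e0; have [delta [d01 dC]] := choose_delta slack_ge0 (ltac:(lra) : 0 < eps / 2).
(* The probability bound 1/2 costs [ln 2 / N], at most [eps / 2] for these [N]; the other half of
   [eps] pays for [delta]. *)
have [N0 H] := eventually_and (eventually_and (eventually_large 1)
  (eventually_mul_large (2 * ln 2) e0))
  (eventually_and (card_near_lower d01) (perm_avg_near d01.1)).
exists N0 => N /H [NL [cnt avg]].
set c := INR #|_| in cnt; set G := perm_avg h (Xi N) in avg *.
have G0 : 0 < G by exact: perm_avg_gt0.
(* Each of the [c] copies of [G] is exchanged for the average at a typical family; the permutations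
   disappear, and the sum is enlarged to all words, where the Gibbs mass is 1. *)
have Gc : c * G <= exp (INR N * pressure h) * exp (INR N * (delta * lip_const)).
  rewrite -rsum_const.
  apply: Rle_trans (_ : \big[Rplus/0]_(w : {ffun 'I_N -> A} | near delta w)
    (perm_avg h (col w) * exp (INR N * (delta * lip_const))) <= _).
    by apply: rsum_le => w /avg[].
  rewrite -big_distrl /=; apply: Rmult_le_compat_r; first by left; exact: exp_pos.
  rewrite sum_perm_avg; last by move=> s w; exact: near_shuffle.
  apply: Rle_trans (_ : \big[Rplus/0]_(w : {ffun 'I_N -> A})
    exp (\big[Rplus/0]_(j < N) h (w j)) <= _).
    by apply: rsum_sub => // w; left; exact: exp_pos.
  under eq_bigr do rewrite exp_sum_gibbs.
  by rewrite -big_distrr /= iid_total (gibbs_sum a0) pow1; lra.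
have key : G <= exp (ln 2 + INR N * (pressure h - total_entropy + eps / 2)).
  apply: Rle_trans (_ : exp (ln 2 + INR N * (pressure h - total_entropy +
    delta * (log_bound + lip_const))) <= _); last first.
    by apply: Rexp_le; apply: Rplus_le_compat_l; apply: Rmult_le_compat_l; lra.
  have -> : ln 2 + INR N * (pressure h - total_entropy + delta * (log_bound + lip_const)) =
    ln 2 + (INR N * pressure h + INR N * (delta * lip_const) +
    INR N * (delta * log_bound - total_entropy)) by ring.
  rewrite exp_plus exp_ln; last lra.
  rewrite exp_plus exp_plus.
  set e1 := exp (INR N * (delta * log_bound - total_entropy)) in cnt *.
  have e10 : 0 < e1 by exact: exp_pos.
  by have := Rmult_le_compat_r _ _ _ (Rlt_le _ _ e10) Gc; nra.
rewrite Psym_termE -/G; apply: (Rmult_le_reg_l (INR N)); first lra.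
rewrite -Rmult_assoc Rinv_r ?Rmult_1_l; last lra.
have : ln G <= ln (exp (ln 2 + INR N * (pressure h - total_entropy + eps / 2))).
  by case: key => [?|->]; [left; exact: ln_increasing|lra].
by rewrite ln_exp; lra.
Qed.

(** The comparison reversed: as the [mu i] are the Gibbs marginals, restricting to typical words
    loses at most half of the Gibbs mass. *)
Lemma Psym_term_lower eps : 0 < eps ->
  (forall i t, mu i t = \big[Rplus/0]_(a : A | a i == t) gibbs h a) ->
  eventually (fun N => pressure h - total_entropy - eps <= Psym_term h Xi N).
Proof.
move=> e0 marg; have [delta [d01 dC]] := choose_delta slack_ge0 (ltac:(lra) : 0 < eps / 2).
(* Gibbs marginals are positive, as the upper bound on the number of typical families requires. *)
have mu0 i t : 0 < mu i t.
  by rewrite marg; apply: (@rsum_gt0 _ _ _ [ffun _ => t]) => [|a _]; rewrite ?ffunE //; exact: gibbs_gt0.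
have [N0 H] := eventually_and (eventually_and (eventually_large 1)
  (eventually_mul_large (2 * ln 2) e0))
  (eventually_and (near_lln d01 (fun a => Rlt_le _ _ (gibbs_gt0 h a)) (gibbs_sum a0 h)
     (fun i t => esym (marg i t))) (perm_avg_near d01.1)).
exists N0 => N /H [NL [lln avg]].
have := card_near_upper delta N mu0.
set c := INR #|_| => cnt; set G := perm_avg h (Xi N) in avg *.
have G0 : 0 < G by exact: perm_avg_gt0.
have Gc : exp (INR N * pressure h) * (1/2) <= c * (G * exp (INR N * (delta * lip_const))).
  rewrite -rsum_const.
  apply: Rle_trans (_ : \big[Rplus/0]_(w : {ffun 'I_N -> A} | near delta w)
    perm_avg h (col w) <= _); last by apply: rsum_le => w /avg[].
  rewrite sum_perm_avg; last by move=> s w; exact: near_shuffle.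
  under eq_bigr do rewrite exp_sum_gibbs.
  rewrite -big_distrr /=; apply: Rmult_le_compat_l => //; left; exact: exp_pos.
have key : exp (INR N * (pressure h - total_entropy - eps / 2) - ln 2) <= G.
  apply: Rle_trans (_ : exp (INR N * (pressure h - total_entropy -
    delta * (log_bound + lip_const)) - ln 2) <= _).
    by apply: Rexp_le; apply: Rplus_le_compat_r; apply: Rmult_le_compat_l; lra.
  apply: (Rmult_le_reg_r (exp (INR N * (delta * lip_const)))); first exact: exp_pos.
  rewrite -exp_plus.
  have -> : INR N * (pressure h - total_entropy - delta * (log_bound + lip_const)) - ln 2
     + INR N * (delta * lip_const) =
     INR N * pressure h + - ln 2 + - (INR N * (delta * log_bound + total_entropy)) by ring.
  rewrite 2!exp_plus (exp_Ropp (ln 2)) exp_ln; last lra.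
  set e1 := exp (- _) in cnt *; set e2 := exp (INR N * (delta * lip_const)) in Gc *.
  have e10 : 0 < e1 by exact: exp_pos.
  have e20 : 0 < G * e2 by apply: Rmult_lt_0_compat => //; exact: exp_pos.
  have := Rmult_le_compat_r _ _ _ (Rlt_le _ _ e10) Gc.
  by have := Rmult_le_compat_r _ _ _ (Rlt_le _ _ e20) cnt; lra.
rewrite Psym_termE -/G; apply: (Rmult_le_reg_l (INR N)); first lra.
rewrite -[X in _ <= X]Rmult_assoc Rinv_r ?Rmult_1_l; last lra.
have : ln (exp (INR N * (pressure h - total_entropy - eps / 2) - ln 2)) <= ln G.
  by case: key => [?|->]; [left; apply: ln_increasing => //; exact: exp_pos|lra].
by rewrite ln_exp; lra.
Qed.

End Sandwich.

(** * Tilted potentials and Gibbs marginals *)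

Section Perturbation.
Variables (d n : nat) (h : {ffun 'I_n -> 'I_d} -> R) (i : 'I_n) (t : 'I_d) (s : R).
Local Notation A := {ffun 'I_n -> 'I_d}.

Definition tilt (a : A) : R := h a + s * (if a i == t then 1 else 0).

(** The added term sums to [s] times the count of [t] in the [i]-th word, which no permutation
    changes, so it factors out of the average. *)
Lemma perm_avg_tilt N (xs : 'I_n -> {ffun 'I_N -> 'I_d}) :
  perm_avg tilt xs = perm_avg h xs * exp (s * INR (occ (xs i) t)).
Proof.
rewrite /perm_avg Rmult_assoc big_distrl /=; congr Rmult; apply: eq_bigr => u _.
rewrite -exp_plus; congr exp; rewrite /Nkappa big_split /=; congr Rplus.
rewrite -(occ_perm_act (u i)) /occ card_rsum big_distrr /=.
by apply: eq_bigr => j _; rewrite ffunE.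
Qed.

Lemma Psym_term_tilt (Xi : forall N : nat, 'I_n -> {ffun 'I_N -> 'I_d}) N :
  Psym_term tilt Xi N = Psym_term h Xi N + s * type_of (Xi N i) t.
Proof.
rewrite !Psym_termE perm_avg_tilt ln_mult ?ln_exp; first last.
- exact: exp_pos.
- exact: perm_avg_gt0.
by rewrite /type_of -/(occ _ _) /Rdiv; ring.
Qed.

(** The ratio of partition functions is the exponential moment of the indicator of [a i = t] under
    the Gibbs measure. *)
Lemma exp_pressure_tilt (a0 : A) : exp (pressure tilt) =
  exp (pressure h) * (1 + (exp s - 1) * \big[Rplus/0]_(a : A | a i == t) gibbs h a).
Proof.
rewrite (exp_pressure a0 tilt) (big_mkcond (fun a : A => a i == t)).
rewrite [X in (1 + X)]big_distrr /=.
rewrite -[X in X + _](gibbs_sum a0 h) -big_split big_distrr /=; apply: eq_bigr => a _.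
rewrite exp_plus -gibbsK.
by case: ifP => _; rewrite ?Rmult_1_r ?Rmult_0_r ?exp_0; ring.
Qed.

End Perturbation.

(* The derivative at [s = 0] of the two sides. *)
Lemma tilt_bound_eq (m u : R) : 0 <= m <= 1 ->
  (forall s, exp (s * u) <= 1 + (exp s - 1) * m) -> u = m.
Proof.
move=> m01 H.
have {}H s : s <= 1/2 -> s * u <= s * m + 2 * s ^ 2.
  move=> s2; have := H s; have := exp_ineq1_le (s * u).
  have := exp_le_quadratic s2; have := pow2_ge_0 s; nra.
apply: Rle_antisym; apply: Rle_eps => eps e0; set s := Rmin (1/2) (eps / 2).
all: have s0 : 0 < s by apply: Rmin_glb_lt; lra.
all: have s1 : s <= 1/2 by exact: Rmin_l.
all: have s2 : s <= eps / 2 by exact: Rmin_r.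
  have := H s s1; move=> K.
  have : u <= m + 2 * s by apply: (Rmult_le_reg_l s) => //; lra.
  lra.
have K := H (- s) ltac:(lra).
have : m <= u + 2 * s by apply: (Rmult_le_reg_l s) => //; lra.
lra.
Qed.

(** The fibres of [a |-> a i] partition [X^n], so [hmarg h i] has the same pressure as [h]. *)
Lemma gibbs_hmarg d n (h : {ffun 'I_n -> 'I_d} -> R) i t :
  gibbs (hmarg h i) t = \big[Rplus/0]_(a : {ffun 'I_n -> 'I_d} | a i == t) gibbs h a.
Proof.
have W0 t' : 0 < \big[Rplus/0]_(a : {ffun 'I_n -> 'I_d} | a i == t') exp (h a).
  apply: (@rsum_gt0 _ _ _ [ffun _ => t']) => [|a _]; first by rewrite ffunE.
  exact: exp_pos.
have -> : gibbs (hmarg h i) t = exp (hmarg h i t - pressure h).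
  rewrite /gibbs; congr (exp (_ - ln _)).
  rewrite [RHS](partition_big (fun a : {ffun 'I_n -> 'I_d} => a i) xpredT) //=.
  by apply: eq_bigr => t' _; rewrite exp_ln.
rewrite /Rminus exp_plus exp_ln // big_distrl /=.
by apply: eq_bigr => a _; rewrite -exp_plus.
Qed.

(** * Passage to the limit superior and the equality case *)

Section Limsup.
Variables (u : nat -> R) (l : R).
Hypothesis Hl : is_limsup u l.

(** Terms close to [l] occur at arbitrarily large [N]. The convergent correction [v] carries the
    effect of a tilt, so that no limsup of tilted terms has to be introduced. *)
Lemma is_limsup_le_eventually (v : nat -> R) (b c : R) : Un_cv v c ->
  (forall eps, 0 < eps -> eventually (fun N => u N + v N <= b + eps)) -> l + c <= b.
Proof.
move=> cv H; apply: Rle_eps => eps e0; have e3 : 0 < eps / 3 by lra.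
have [N0 HN0] := eventually_and (H _ e3) (eventually_Un_cv cv e3).
have [_ /(_ N0)[N [/HN0[uv vc] uN]]] := Hl e3.
by have := Rle_abs (- (v N - c)); rewrite Rabs_Ropp; lra.
Qed.

Lemma is_limsup_ge_eventually (b : R) :
  (forall eps, 0 < eps -> eventually (fun N => b - eps <= u N)) -> b <= l.
Proof.
move=> H; apply: Rle_eps => eps e0; have e2 : 0 < eps / 2 by lra.
have [[N1 H1] _] := Hl e2; have [N0 H0] := H _ e2.
have := H1 _ (leq_maxr N0 N1); have := H0 _ (leq_maxl N0 N1); lra.
Qed.

End Limsup.

Theorem theorem4p4 (d n : nat) (h : {ffun 'I_n -> 'I_d} -> R)
    (mu : 'I_n -> 'I_d -> R)
    (Hmu : forall i, is_prob (mu i))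
    (Xi : forall N : nat, 'I_n -> {ffun 'I_N -> 'I_d})
    (HXi : approx_seq mu Xi)
    (Psym : R) (HPsym : is_limsup (Psym_term h Xi) Psym) :
  Psym + \rsum_(i : 'I_n) entropy (mu i) <= pressure h /\
  ((pressure h = Psym + \rsum_(i : 'I_n) entropy (mu i)) <->
     (forall i t, mu i t = \big[Rplus/0]_(x : {ffun 'I_n -> 'I_d} | x i == t) gibbs h x)) /\
  ((forall i t, mu i t = \big[Rplus/0]_(x : {ffun 'I_n -> 'I_d} | x i == t) gibbs h x) <->
     (forall i t, mu i t = gibbs (hmarg h i) t)).
Proof.
rewrite -/(total_entropy mu); set S := total_entropy mu.
have a0 : {ffun 'I_n -> 'I_d} := [ffun i => Xi 1%N i ord0].
have upper : Psym + 0 <= pressure h - S.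
  apply: (is_limsup_le_eventually HPsym (v := fun=> 0)).
    by move=> eps e0; exists 0%N => N _; rewrite /Rdist Rminus_diag Rabs_R0.
  move=> eps e0; have [N0 H] := Psym_term_upper Hmu HXi h e0.
  by exists N0 => N /H; rewrite Rplus_0_r.
split; first lra.
split; last by split=> H i t; rewrite H gibbs_hmarg.
split=> [eqP i t|marg]; last first.
  have : pressure h - S <= Psym; last lra.
  apply: (is_limsup_ge_eventually HPsym) => eps e0.
  exact: (Psym_term_lower Hmu HXi e0 marg).
have gibbs_ge0 a : 0 <= gibbs h a by left; exact: gibbs_gt0.
apply: tilt_bound_eq => [|s].
  split; first by apply: rsum_ge0.
  by apply: Rle_trans (Req_le _ _ (gibbs_sum a0 h)); exact: rsum_sub.
(* The upper bound for the tilted potential, read on the terms for [h] with a correction tending to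
   [s * mu i t]. *)
have tilted : Psym + s * mu i t <= pressure (tilt h i t s) - S.
  apply: (is_limsup_le_eventually HPsym (v := fun N => s * type_of (Xi N i) t)).
    apply: CV_mult (HXi.2 i t).
    by move=> eps e0; exists 0%N => N _; rewrite /Rdist Rminus_diag Rabs_R0.
  move=> eps e0; have [N0 H] := Psym_term_upper Hmu HXi (tilt h i t s) e0.
  by exists N0 => N /H; rewrite Psym_term_tilt.
(* With [Psym + S = pressure h], the bound [tilted] exponentiates to the inequality required at
   [s]. *)
apply: (Rmult_le_reg_l (exp (pressure h))); first exact: exp_pos.
by rewrite -exp_plus -exp_pressure_tilt //; apply: Rexp_le; lra.
Qed.
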